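(* Let $q=2^m$ with $m$ odd, and let $c_1,c_2\in\mathbb{F}_{q^2}$ and $\gamma\in\mathbb{F}_{q^2}\setminus\mathbb{F}_q$ satisfy $$\gamma^{3(q-1)}=1,\qquad 1+\mathrm{Tr}_q^{q^2}(c_1\gamma)=\gamma^{2q-1},\qquad \mathrm{Tr}_q^{q^2}(c_2\gamma^q)=0.$$ Put $h_2(x)=\mathrm{Tr}_q^{q^2}\bigl(c_1x+c_2x^2+x^{2q-1}\bigr)$ and $f_2(x)=x+\gamma h_2(x)$. Then $f_2$ is a permutation polynomial of $\mathbb{F}_{q^2}$ and its compositional inverse is $$f_2^{-1}(x)=\begin{cases}0 & \text{if } x=0,\\[6pt] x+\gamma^{q-1}\Bigl(h_2(x)+\dfrac{\mathrm{Tr}_q^{q^2}(x^3)}{x^{q+1}}\Bigr) & \text{if } x\neq0,\ r=0,\\[10pt] x+\gamma^{q-1}\Bigl(h_2(x)+\dfrac{\mathrm{Tr}_q^{q^2}(x^3)}{x^{q+1}}+r^{1/3}+\dfrac{P}{r^{1/3}}\Bigr) & \text{if } x\neq0,\ r\neq0,\end{cases}$$ where (for $x\ne 0$) $$P=h_2(x)^2+h_2(x)\,\mathrm{Tr}_q^{q^2}\bigl(\gamma^{q-1}x^q\bigr)+\frac{\mathrm{Tr}_q^{q^2}(\gamma x)^3\,\mathrm{Tr}_q^{q^2}(x)^3}{\gamma^3\,x^{2q+2}},\qquad r=P\Bigl(h_2(x)+\frac{\mathrm{Tr}_q^{q^2}(x)^3}{x^{q+1}}\Bigr).$$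
   Context: $m\ge 1$ is an integer and $\mathbb{F}_q$ denotes the finite field with $q$ elements. $\mathrm{Tr}_q^{q^2}:\mathbb{F}_{q^2}\to\mathbb{F}_q$ is the relative trace $\mathrm{Tr}_q^{q^2}(x)=x+x^q$. A polynomial $f$ over $\mathbb{F}_{q^2}$ is a permutation polynomial of $\mathbb{F}_{q^2}$ if the map $a\mapsto f(a)$ is a bijection of $\mathbb{F}_{q^2}$; its compositional inverse $f^{-1}$ is the inverse map. For $m$ odd, $(\cdot)^{1/3}$ denotes the unique cube root in $\mathbb{F}_q$, i.e. the inverse of the bijection $t\mapsto t^3$ of $\mathbb{F}_q$ (the quantity $r$ lies in $\mathbb{F}_q$). *)

(* Defs.v *)
From mathcomp Require Import all_boot all_algebra.
From mathcomp Require Import zify.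

Set Implicit Arguments.
Unset Strict Implicit.
Unset Printing Implicit Defensive.

Import GRing.Theory.
Local Open Scope ring_scope.

(* In a field F with q ^ 2 elements, the subfield with q elements is the set of
   roots of 'X^q - 'X. *)
Definition Fq (q : nat) (F : finFieldType) : {set F} := [set x | x ^+ q == x].

(* Stated over an arbitrary ring so that it applies both to elements of F and
   to polynomials over F. *)
Definition relTr (R : nzRingType) (q : nat) (x : R) : R := x + x ^+ q.

Definition permutation_poly (F : finFieldType) (f : {poly F}) : Prop :=
  bijective (horner f).

Definition compositional_inverse (F : finFieldType) (f : {poly F}) (g : F -> F)
  : Prop := cancel (horner f) g /\ cancel g (horner f).

(* The cube root of t in F_q; the value is 0 when there is none, which by
   cbrtP never happens for t in F_q when q = 2 ^ m with m odd. *)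
Definition cbrt (q : nat) (F : finFieldType) (t : F) : F :=
  odflt 0 [pick s in Fq q F | s ^+ 3 == t].

Section CubeRoot.
Variables (m : nat) (F : finFieldType).
Hypothesis m_odd : odd m.
Let q := (2 ^ m)%N.

Let k_ex : exists k, (3 * k = 2 * q - 1)%N.
Proof.
have [j j_eq] : exists j, (q = 3 * j + 2)%N; last by exists (2 * j + 1)%N; lia.
rewrite /q -(odd_double_half m) m_odd; elim: m./2 => [|h [j hj]].
  by exists 0.
by exists (4 * j + 2)%N; rewrite doubleS !addnS !expnS -expnS hj; lia.
Qed.

Let Fq_exp (t : F) : t \in Fq q F -> t ^+ (2 * q - 1) = t.
Proof.
rewrite inE => /eqP tq; have q_gt0 : (0 < q)%N by rewrite expn_gt0.
have [->|t_neq0] := eqVneq t 0; first by rewrite expr0n; case: eqP => //; lia.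
apply: (mulfI t_neq0); rewrite -exprS.
have -> : (2 * q - 1).+1 = (q * 2)%N by lia.
by rewrite exprM tq expr2.
Qed.

Lemma cube_inj_Fq : {in Fq q F &, injective (fun t : F => t ^+ 3)}.
Proof.
have [k k_eq] := k_ex; move=> s t Fs Ft /= st.
by rewrite -(Fq_exp Fs) -(Fq_exp Ft) -k_eq !exprM st.
Qed.

Lemma cbrtP (t : F) : t \in Fq q F -> cbrt q t \in Fq q F /\ cbrt q t ^+ 3 = t.
Proof.
move=> Ft; rewrite /cbrt; case: pickP => [s /andP[Fs /eqP st] //|no_root].
have [k k_eq] := k_ex; have /negP[] := negbT (no_root (t ^+ k)).
rewrite -exprM mulnC k_eq Fq_exp // eqxx andbT inE.
by move: Ft; rewrite inE => /eqP tq; rewrite exprAC tq.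
Qed.

End CubeRoot.

Section Polynomials.
Variables (q : nat) (F : finFieldType) (c1 c2 gam : F).

Definition h2 : {poly F} :=
  relTr q (c1%:P * 'X + c2%:P * 'X^2 + 'X^(2 * q - 1)).

Definition f2 : {poly F} := 'X + gam%:P * h2.

Definition P2 (x : F) : F :=
  h2.[x] ^+ 2 + h2.[x] * relTr q (gam ^+ (q - 1) * x ^+ q)
  + relTr q (gam * x) ^+ 3 * relTr q x ^+ 3 / (gam ^+ 3 * x ^+ (2 * q + 2)).

Definition r2 (x : F) : F :=
  P2 x * (h2.[x] + relTr q x ^+ 3 / x ^+ (q + 1)).

Definition f2_inv (x : F) : F :=
  if x == 0 then 0
  else if r2 x == 0 then
    x + gam ^+ (q - 1) * (h2.[x] + relTr q (x ^+ 3) / x ^+ (q + 1))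
  else
    x + gam ^+ (q - 1) *
      (h2.[x] + relTr q (x ^+ 3) / x ^+ (q + 1)
       + cbrt q (r2 x) + P2 x / cbrt q (r2 x)).

End Polynomials.

(* Main.v *)
Require Import Defs.
From mathcomp Require Import all_boot all_algebra.
From mathcomp Require Import finfield ring zify.

Set Implicit Arguments.
Unset Strict Implicit.
Unset Printing Implicit Defensive.

Import GRing.Theory.
Local Open Scope ring_scope.

(** Let [w = gam ^+ (q - 1)]. It is not 1 because [gam] lies outside F_q, so it
    is a primitive cube root of unity; as [w ^+ (q + 1) = 1], conjugation
    [x |-> x ^+ q] sends [w] to [w ^+ 2 = w + 1]. Hence every element of F is
    [a + b * w] with [a], [b] in F_q, and [gam = w * g] with [g] in F_q. The
    polynomial [f2] moves a point along the line [F_q * w] only, so solving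
    [f2 x = y] for [y = a + b * w] means finding [B] in F_q with
    [x = a + B * w].

    Split [h2.[x]] as [lin x + Tr (x ^+ (2 * q - 1))], where
    [lin x = Tr (c1 * x + c2 * x ^+ 2)]. The conditions on [c1] and [c2] say
    exactly that [lin] is affine along [F_q * w], with slope [(g + 1) / g]
    ([lin_shift]). This turns [f2 x = y] into [B + l = Tr (x ^+ (2 * q - 1))],
    where [l = lin y + b]. For nonzero [x] the right-hand side is the quotient
    [a * B * (a + B) / (a ^+ 2 + a * B + B ^+ 2)] ([relTr_quot]), so clearing
    the denominator and putting [C = B + l] leaves the depressed cubic
      [C ^+ 3 + P * C + a * P = 0],  [P = l * (l + a)].
    Its quadratic resolvent [z ^+ 2 + a * P * z + P ^+ 3] has the two roots
    [P * l] and [P * (l + a)], both in F_q, where cubing is bijective because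
    [m] is odd. When [P] is nonzero, Cardano's formula therefore gives the root
    [s + P / s] with [s ^+ 3 = P * l] ([cardano]); when [P] is zero the root is
    0. The quantities [P2 y] and [r2 y] are [P] and [P * l] ([P2_coord],
    [r2_coord]), so [f2_inv y] is built from this root and
    [f2 (f2_inv y) = y]. As F is finite, a right inverse of a self-map of F is
    its two-sided inverse. *)

(** * The cubic in characteristic 2 *)

Section CharTwo.
Variable F : fieldType.
Hypothesis two0 : 2 = 0 :> F.

(* The integer coefficients produced by expanding cubes, reduced modulo 2. *)
Lemma three_char2 : 3 = 1 :> F.
Proof. by rewrite -[RHS]add0r -two0; ring. Qed.

Lemma four_char2 : 4 = 0 :> F.
Proof. by rewrite -[RHS](mulr0 2) -two0; ring. Qed.

Let three1 := three_char2.
Let four0 := four_char2.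

Lemma addr_char2 (x : F) : x + x = 0.
Proof. by ring: two0. Qed.

Lemma addr_eq0_char2 (x y : F) : x + y = 0 -> x = y.
Proof. by move=> xy; rewrite -[x]addr0 -(addr_char2 y) addrA xy add0r. Qed.

(** Let [P = l * (l + a)]. With [t = P / s] one has [s * t = P] and
    [s ^+ 3 * t ^+ 3 = P ^+ 3], so [t ^+ 3 = P * (l + a)] is the other root of
    the resolvent; the cubic for [s + t] follows by expanding its cube. *)
Lemma cardano (a l s : F) : s != 0 ->
    s ^+ 3 = l * (l + a) * l ->
  let C := s + l * (l + a) / s in
  C ^+ 3 + l * (l + a) * C + a * (l * (l + a)) = 0.
Proof.
move=> s_neq0 s3 C; set t := l * (l + a) / s in C *.
have st : l * (l + a) = s * t by rewrite /t [RHS]mulrC divfK.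
have t3 : t ^+ 3 = l * (l + a) * (l + a).
  apply: (mulfI (expf_neq0 3 s_neq0)); rewrite -exprMn -st s3; ring.
transitivity (s ^+ 3 + t ^+ 3 + a * (l * (l + a))).
  by rewrite st /C; ring: two0 three1 four0.
by rewrite s3 t3; ring: two0 three1 four0.
Qed.

(** The substitution [B = C + l] removes the quadratic term of the equation. *)
Lemma depressed_cubic (a l C : F) :
    C ^+ 3 + l * (l + a) * C + a * (l * (l + a)) = 0 ->
  let B := C + l in
  C * (a ^+ 2 + a * B + B ^+ 2) = a * B * (a + B).
Proof.
move=> cubic B; apply: addr_eq0_char2; rewrite -cubic /B.
by ring: two0 three1 four0.
Qed.

(** The expressions for [l] and [l * (l + a)] that occur in [r2] and [P2]. They
    hold because [l = L + T + b ^+ 3 / N] and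
    [l + a = L + T + (a + b) ^+ 3 / N], where
    [b ^+ 3 + (a + b) ^+ 3 = a * N]. *)
Lemma resolvent_roots (a b L T : F) :
    let N := a ^+ 2 + a * b + b ^+ 2 in
    N != 0 -> T * N = a * b * (a + b) ->
  let l := L + b in
  (L + T) + b ^+ 3 / N = l
  /\ (L + T) ^+ 2 + (L + T) * a + (a + b) ^+ 3 * b ^+ 3 / N ^+ 2 = l * (l + a).
Proof.
move=> N N_neq0 TN l.
have lE : (L + T) + b ^+ 3 / N = l.
  apply: (mulIf N_neq0).
  by rewrite mulrDl (divfK N_neq0) mulrDl TN /l /N; ring: two0 three1 four0.
have laE : (L + T) + (a + b) ^+ 3 / N = l + a.
  apply: (mulIf N_neq0).
  by rewrite mulrDl (divfK N_neq0) mulrDl TN /l /N; ring: two0 three1 four0.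
split=> //; rewrite -{1}lE -laE.
have aE : a = (b ^+ 3 + (a + b) ^+ 3) / N.
  by apply: (mulIf N_neq0); rewrite (divfK N_neq0) /N; ring: two0 three1 four0.
by rewrite {1}aE expr2 invfM; ring.
Qed.

End CharTwo.

(** * Coordinates over the subfield *)

Section Inverse.
Variables (m q : nat) (F : finFieldType) (c1 c2 gam : F).
Hypothesis m_odd : odd m.
Hypothesis q_def : q = (2 ^ m)%N.
Hypothesis card_F : #|F| = (q ^ 2)%N.
Hypothesis gam_notin : gam \notin Fq q F.
Hypothesis gam_exp : gam ^+ (3 * (q - 1)) = 1.
Hypothesis c1_cond : 1 + relTr q (c1 * gam) = gam ^+ (2 * q - 1).
Hypothesis c2_cond : relTr q (c2 * gam ^+ q) = 0.

Let q_gt0 : (0 < q)%N. Proof. by rewrite q_def expn_gt0. Qed.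

Let pchar2 : 2 \in [pchar F].
Proof.
by apply: (@card_finPcharP F 2 (m * 2)); rewrite // card_F q_def expnM.
Qed.

Let two0 : 2 = 0 :> F. Proof. exact: pcharf0 pchar2. Qed.

Let three1 : 3 = 1 :> F. Proof. exact: three_char2. Qed.
Let four0 : 4 = 0 :> F. Proof. exact: four_char2. Qed.

Let conjD (x y : F) : (x + y) ^+ q = x ^+ q + y ^+ q.
Proof.
apply: exprDn_pchar; rewrite (eq_pnat _ (pcharf_eq pchar2)) q_def.
by rewrite pnatX pnat_id.
Qed.

Let conjM (x y : F) : (x * y) ^+ q = x ^+ q * y ^+ q.
Proof. exact: exprMn. Qed.

Let conjX (x : F) n : (x ^+ n) ^+ q = (x ^+ q) ^+ n.
Proof. exact: exprAC. Qed.

Let conjK (x : F) : (x ^+ q) ^+ q = x.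
Proof. by rewrite -exprM -[RHS](expf_card x) card_F. Qed.

Let conj_relTr (x : F) : relTr q x ^+ q = relTr q x.
Proof. by rewrite /relTr conjD conjK addrC. Qed.

Let relTr0 : relTr q (0 : F) = 0.
Proof. by rewrite /relTr expr0n eqn0Ngt q_gt0 addr0. Qed.

Let relTrD (x y : F) : relTr q (x + y) = relTr q x + relTr q y.
Proof. by rewrite /relTr conjD addrACA. Qed.

Let relTrZ (u x : F) : u ^+ q = u -> relTr q (u * x) = u * relTr q x.
Proof. by move=> uq; rewrite /relTr conjM uq mulrDr. Qed.

Let w := gam ^+ (q - 1).
Let g := w ^+ 2 * gam.

Let gam_neq0 : gam != 0.
Proof.
by apply: contraNneq gam_notin => ->; rewrite inE expr0n eqn0Ngt q_gt0.
Qed.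

Let conj_gam : gam ^+ q = w * gam.
Proof. by rewrite /w -exprSr; congr (_ ^+ _); lia. Qed.

Let w3 : w ^+ 3 = 1.
Proof. by rewrite /w -exprM mulnC. Qed.

Let w2 : w ^+ 2 = w + 1.
Proof.
have w_neq1 : w - 1 != 0.
  rewrite subr_eq0; apply: contraNneq gam_notin => w1.
  by rewrite inE conj_gam w1 mul1r.
apply: (addr_eq0_char2 two0); apply: (mulfI w_neq1); rewrite mulr0.
by transitivity (w ^+ 3 - 1); [ring | rewrite w3 subrr].
Qed.

Let conj_w : w ^+ q = w + 1.
Proof.
have w_neq0 : w != 0 by rewrite expf_neq0.
have norm_w : w * w ^+ q = 1.
  apply: (mulIf gam_neq0).
  by rewrite mul1r -[RHS]conjK conj_gam conjM conj_gam; ring.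
by apply: (mulfI w_neq0); rewrite norm_w -w2 -exprS w3.
Qed.

Let gamE : gam = w * g.
Proof. by rewrite /g mulrA -exprS w3 mul1r. Qed.

Let conj_g : g ^+ q = g.
Proof.
rewrite /g conjM conjX conj_w conj_gam -w2.
by transitivity (w ^+ 3 * (w ^+ 2 * gam)); [ring | rewrite w3 mul1r].
Qed.

Let g_neq0 : g != 0.
Proof. by rewrite mulf_neq0 // !expf_neq0. Qed.

Let c1_trace : g * relTr q (c1 * w) = g + 1.
Proof.
rewrite -relTrZ // mulrCA [g * w]mulrC -gamE.
apply: (addr_eq0_char2 two0).
have <- : 1 + relTr q (c1 * gam) = g.
  rewrite c1_cond /g /w -exprM -exprSr; congr (_ ^+ _); lia.
by ring: two0 three1 four0.
Qed.

Let c2_trace : relTr q (c2 * w ^+ 2) = 0.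
Proof.
apply: (mulfI g_neq0); rewrite mulr0 -relTrZ // -[RHS]c2_cond conj_gam.
by congr relTr; rewrite gamE; ring.
Qed.

Let lin (x : F) : F := relTr q (c1 * x + c2 * x ^+ 2).

Let lin0 : lin 0 = 0.
Proof. by rewrite /lin expr0n !mulr0 addr0 relTr0. Qed.

Let horner_h2 (x : F) : (h2 q c1 c2).[x] = lin x + relTr q (x ^+ (2 * q - 1)).
Proof. by rewrite /lin -relTrD /relTr /h2 /relTr !hornerE. Qed.

Let horner_f2 (x : F) :
  (f2 q c1 c2 gam).[x] = x + gam * (lin x + relTr q (x ^+ (2 * q - 1))).
Proof. by rewrite /f2 hornerD hornerX hornerM hornerC horner_h2. Qed.

(** The quadratic part vanishes along the line because [Tr (c2 * w ^+ 2) = 0],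
    and the linear part has slope [Tr (c1 * w) = (g + 1) / g]. *)
Let lin_shift (x u : F) : u ^+ q = u ->
  g * lin (x + w * u) = g * lin x + (g + 1) * u.
Proof.
move=> uq; rewrite /lin.
have -> : c1 * (x + w * u) + c2 * (x + w * u) ^+ 2
   = c1 * x + c2 * x ^+ 2 + (u * (c1 * w) + u ^+ 2 * (c2 * w ^+ 2)).
  by ring: two0 three1 four0.
rewrite relTrD [X in _ + X]relTrD (relTrZ _ uq).
rewrite (@relTrZ (u ^+ 2)) ?conjX ?uq // c2_trace -c1_trace.
by ring.
Qed.

Section Coordinates.
Variables a b : F.
Hypotheses (aq : a ^+ q = a) (bq : b ^+ q = b).
Let y := a + b * w.
Let N := a ^+ 2 + a * b + b ^+ 2.

Let conj_coord : y ^+ q = a + b * (w + 1).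
Proof. by rewrite /y conjD conjM aq bq conj_w. Qed.

Lemma relTr_coord : relTr q y = b.
Proof. by rewrite /relTr conj_coord /y; ring: two0 three1 four0. Qed.

Lemma norm_coord : y ^+ (q + 1) = N.
Proof.
rewrite exprD expr1 conj_coord /y /N.
by transitivity (a ^+ 2 + a * b * (1 + 2 * w) + b ^+ 2 * (w ^+ 2 + w));
  [ring | rewrite w2; ring: two0 three1 four0].
Qed.

Lemma norm_coord_neq0 : y != 0 -> N != 0.
Proof. by move=> y_neq0; rewrite -norm_coord expf_neq0. Qed.

(** Modulo [q ^ 2 - 1] the two exponents on the left are [3 * q] and [3]. *)
Lemma relTr_quot_norm : relTr q (y ^+ (2 * q - 1)) * N = relTr q (y ^+ 3).
Proof.
rewrite -norm_coord /relTr mulrDl addrC; congr (_ + _).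
  rewrite -exprM -exprD.
  have -> : ((2 * q - 1) * q + (q + 1) = q * q * 2 + 1)%N by nia.
  by rewrite exprD !exprM conjK expr1 -exprSr.
by rewrite -exprD -exprM; congr (_ ^+ _); lia.
Qed.

Lemma relTr_quot : relTr q (y ^+ (2 * q - 1)) * N = a * b * (a + b).
Proof.
rewrite relTr_quot_norm /relTr conjX conj_coord /y.
have six0 : 6 = 0 :> F by rewrite -[RHS](mulr0 3) -two0; ring.
by ring: two0 three1 four0 six0 w2.
Qed.

Lemma coord_eq0 : y = 0 -> a = 0 /\ b = 0.
Proof.
move=> y0; have b0 : b = 0.
  by rewrite -relTr_coord y0 relTr0.
by move: y0; rewrite /y b0 mul0r addr0.
Qed.

End Coordinates.

Let conj_lin (x : F) : lin x ^+ q = lin x. Proof. exact: conj_relTr. Qed.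

(** A root [C] gives [Tr (x ^+ (2 * q - 1)) = C] after division by the norm of
    [x = a + (C + l) * w]. The case [x = 0] is impossible: it forces [a = 0],
    hence [C = 0] and then [l = 0], whereas [g * l = b] on the line [a = 0]. *)
Lemma f2_cubic_root (a b C : F) (y := a + b * w) (l := lin y + b) :
    a ^+ q = a -> b ^+ q = b -> C ^+ q = C -> y != 0 ->
    C ^+ 3 + l * (l + a) * C + a * (l * (l + a)) = 0 ->
    (a = 0 -> C = 0) ->
  (f2 q c1 c2 gam).[y + w * (lin y + C)] = y.
Proof.
move=> aq bq Cq y_neq0 cubic C0; set u := lin y + C; set x := y + w * u.
have lq : l ^+ q = l by rewrite conjD conj_lin bq.
have uq : u ^+ q = u by rewrite conjD conj_lin Cq.
have xE : x = a + (C + l) * w.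
  by rewrite /x /l /u /y; ring: two0.
have Bq : (C + l) ^+ q = C + l by rewrite conjD Cq lq.
have x_neq0 : x != 0.
  apply/eqP; rewrite xE => /(coord_eq0 aq Bq)[a0 B0].
  have l0 : l = 0 by rewrite -B0 C0 // add0r.
  have gl : g * l = b.
    rewrite mulrDr /y a0 [b * w]mulrC lin_shift // lin0.
    by ring: two0.
  case/eqP: y_neq0; rewrite /y a0 -gl l0.
  by rewrite mulr0 mul0r addr0.
have trC : relTr q (x ^+ (2 * q - 1)) = C.
  have N_neq0 := norm_coord_neq0 aq Bq; rewrite -xE in N_neq0.
  apply: (mulIf (N_neq0 x_neq0)).
  by rewrite xE relTr_quot // depressed_cubic.
rewrite horner_f2 trC gamE.
transitivity (x + w * (g * lin x) + w * g * C); first by ring.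
by rewrite /x lin_shift // /u; ring: two0 four0.
Qed.

Section Formula.
Variables a b : F.
Hypotheses (aq : a ^+ q = a) (bq : b ^+ q = b).
Let y := a + b * w.
Let l := lin y + b.
Hypothesis y_neq0 : y != 0.

Let N_neq0 : a ^+ 2 + a * b + b ^+ 2 != 0. Proof. exact: norm_coord_neq0. Qed.

Let T_eq : relTr q (y ^+ (2 * q - 1)) * (a ^+ 2 + a * b + b ^+ 2)
  = a * b * (a + b).
Proof. exact: relTr_quot. Qed.

Let relTr_cube :
  relTr q (y ^+ 3) / y ^+ (q + 1) = relTr q (y ^+ (2 * q - 1)).
Proof. by rewrite norm_coord // -relTr_quot_norm // mulfK. Qed.

Lemma P2_coord : P2 q c1 c2 gam y = l * (l + a).
Proof.
have [_ <-] := resolvent_roots two0 (lin y) N_neq0 T_eq.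
have gam3 : gam ^+ 3 = g ^+ 3 by rewrite gamE exprMn w3 mul1r.
have tr_wy : relTr q (gam ^+ (q - 1) * y ^+ q) = a.
  rewrite -/w /relTr conjM conjK conj_w /y conjD conjM aq bq conj_w.
  by ring: two0 three1 four0 w2.
have tr_gy : relTr q (gam * y) = g * (a + b).
  rewrite gamE -mulrA mulrCA relTrZ // /relTr conjM conj_w.
  rewrite /y conjD conjM aq bq conj_w.
  by congr (_ * _); ring: two0 three1 four0 w2.
rewrite /P2 horner_h2 tr_wy tr_gy relTr_coord // gam3.
have -> : (2 * q + 2 = (q + 1) * 2)%N by lia.
rewrite [y ^+ ((q + 1) * 2)]exprM norm_coord // [(g * _) ^+ 3]exprMn.
rewrite -[g ^+ 3 * _ * _]mulrA -mulf_div divff ?expf_neq0 //.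
by rewrite mul1r.
Qed.

Lemma r2_coord : r2 q c1 c2 gam y = l * (l + a) * l.
Proof.
rewrite /r2 P2_coord horner_h2 relTr_coord // norm_coord //.
by have [-> _] := resolvent_roots two0 (lin y) N_neq0 T_eq.
Qed.

(** The term [Tr (y ^+ 3) / y ^+ (q + 1)] in [f2_inv] equals
    [Tr (y ^+ (2 * q - 1))], which cancels the second summand of [h2]; what
    multiplies [w] is then [lin y + C] with [C] the root of the cubic. *)
Lemma f2_invK_coord : (f2 q c1 c2 gam).[f2_inv q c1 c2 gam y] = y.
Proof.
rewrite /f2_inv (negPf y_neq0) r2_coord P2_coord horner_h2 relTr_cube -/w.
set T := relTr q _; have -> : lin y + T + T = lin y.
  by rewrite -addrA (addr_char2 two0) addr0.
have lq : l ^+ q = l by rewrite conjD conj_lin bq.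
have [r0|r_neq0] := eqVneq.
  rewrite -[lin y]addr0; apply: f2_cubic_root => //.
    by rewrite expr0n eqn0Ngt q_gt0.
  have -> : lin y + b = l by [].
  have -> : l * (l + a) = 0.
    by case/eqP: r0; rewrite mulf_eq0 => /orP[/eqP // | /eqP ->]; rewrite mul0r.
  by ring.
set s := cbrt q _.
have rq : l * (l + a) * l \in Fq q F by rewrite inE !conjM conjD lq aq.
have [sq s3] : s \in Fq q F /\ s ^+ 3 = l * (l + a) * l.
  by move: rq; rewrite /s q_def; exact: cbrtP.
have s_neq0 : s != 0 by apply: contraNneq r_neq0 => s0; rewrite -s3 s0 expr0n.
rewrite -[lin y + s + _]addrA; apply: f2_cubic_root => //.
- by move: sq; rewrite inE conjD !conjM exprVn conjD lq aq => /eqP ->.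
- exact: cardano.
(* Here the cubic is [C * (C + l) ^+ 2]; the cube root selects [C = 0]. *)
move=> a0; have -> : s = l.
  apply: (@cube_inj_Fq m F m_odd); rewrite -?q_def // ?inE ?lq //.
  by rewrite s3 a0; ring.
have l_neq0 : l != 0.
  by apply: contraNneq r_neq0 => ->; rewrite mulr0.
by rewrite a0 addr0 mulfK // (addr_char2 two0).
Qed.

End Formula.

Lemma f2_invK : cancel (f2_inv q c1 c2 gam) (horner (f2 q c1 c2 gam)).
Proof.
move=> y; have [->|y_neq0] := eqVneq y 0.
  have n0 : (2 * q - 1 == 0)%N = false by lia.
  by rewrite /f2_inv eqxx horner_f2 lin0 expr0n n0 relTr0 !(addr0, mulr0).
pose b := relTr q y; pose a := y + b * w.
have yE : y = a + b * w by rewrite /a; ring: two0.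
have bq : b ^+ q = b by exact: conj_relTr.
have aq : a ^+ q = a.
  by rewrite /a conjD conjM bq conj_w /b /relTr; ring: two0.
by rewrite yE in y_neq0 *; exact: f2_invK_coord.
Qed.

End Inverse.

Theorem theorem4p7 (m q : nat) (F : finFieldType) (c1 c2 gam : F)
  (m_odd : odd m)
  (q_def : q = (2 ^ m)%N)
  (card_F : #|F| = (q ^ 2)%N)
  (gam_notin : gam \notin Fq q F)
  (gam_exp : gam ^+ (3 * (q - 1)) = 1)
  (c1_cond : 1 + relTr q (c1 * gam) = gam ^+ (2 * q - 1))
  (c2_cond : relTr q (c2 * gam ^+ q) = 0) :
  permutation_poly (f2 q c1 c2 gam) /\
  compositional_inverse (f2 q c1 c2 gam) (f2_inv q c1 c2 gam).
Proof.
have invK := f2_invK m_odd q_def card_F gam_notin gam_exp c1_cond c2_cond.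
have f2K := canF_sym invK.
by split; [exists (f2_inv q c1 c2 gam) | split].
Qed.
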